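(* Let $b\in\mathcal B$ be a block of $G_2(m)$, write $\{i,j,k\}:=\operatorname{supp}(b)$, $R:=\Omega\setminus\{i,j,k\}$, let $\delta:\mathcal B\to\{\pm1\}$ be a decoration, and for $r\in R$ put $$\kappa_{ijkr}=\delta(b)\,\delta(b_{ijr})\,\delta(b_{ikr})\,\delta(b_{jkr}).$$ Define $n^{\delta}_{-1}=n^{\delta}_{-1}(b)=|\{r\in R:\kappa_{ijkr}=-1\}|$. Then $$|\{r\in R:\kappa_{ijkr}=1\}|=m-3-n^{\delta}_{-1}$$ and the multiset spectrum of the operator $L_\delta(c_b^\delta)$ is $$\operatorname{Spec}(L_\delta(c_b^\delta))=\sigma_{n^{\delta}_{-1}},\qquad\text{where}\qquad \sigma_k=\Bigl\{0^{\binom{m-3}{2}},\,1^{m-2-k},\,(-1)^k,\,(-\tfrac12)^{2(m-2-k)},\,(\tfrac12)^{2k}\Bigr\}.$$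
   Context: Let $K$ be a field of characteristic $0$, $m\ge 3$ an integer and $\Omega=\{1,\dots,m\}$. The Grassmannian geometry $G_2(m)$ has point set $\mathcal P=\binom{\Omega}{2}$ (the point $\{i,j\}$ is written $ij$) and block set $\mathcal B$ consisting of the triples $b_{ijk}=\{ij,ik,jk\}$, one for each $3$-subset $\{i,j,k\}\subseteq\Omega$. The support of a block is $\operatorname{supp}(b)=\bigcup_{p\in b}p$, so $\operatorname{supp}(b_{ijk})=\{i,j,k\}$. A decoration is a map $\delta:\mathcal B\to\{\pm1\}$. The decorated incidence algebra $\mathbb A^\delta(G_2(m))$ is the commutative (nonassociative) $K$-algebra with basis $\{e_p:p\in\mathcal P\}$ and bilinear product $\circ_\delta$ given by $e_{ij}\circ_\delta e_{ik}=\delta(b_{ijk})e_{jk}$ for distinct $i,j,k\in\Omega$, and $e_p\circ_\delta e_q=0$ if $p=q$ or $p\cap q=\varnothing$. For a block $b$, the block idempotent is $c_b^\delta=\tfrac12\delta(b)\sum_{p\in b}e_p$, and $L_\delta(c):x\mapsto c\circ_\delta x$. $\operatorname{Spec}(M)$ denotes the multiset of eigenvalues of $M$ counted with algebraic multiplicity; in multiset notation $\lambda^{k}$ means that $\lambda$ occurs with multiplicity $k$ (exponents are multiplicities, not powers). *)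

(* Defs.v *)
From HB Require Import structures.
From mathcomp Require Import all_boot all_order all_algebra.
From mathcomp Require Import finmap multiset boolp.

Set Implicit Arguments.
Unset Strict Implicit.
Unset Printing Implicit Defensive.

Import GRing.Theory passmx.
Local Open Scope ring_scope.

Section Spectrum.
Variables (K : fieldType) (V : vectType K).
Implicit Types (f : 'End(V)) (a : K).

(* The choice of basis is irrelevant, see [char_polyf_basis]. *)
Definition char_polyf f : {poly K} :=
  char_poly (mxof (vbasis {:V}) (vbasis {:V}) f).

Lemma char_polyf_basis (X : (\dim {:V}).-tuple V) f :
  basis_of {:V} X -> char_polyf f = char_poly (mxof X X f).
Proof.
move=> bX; have bV := vbasisP {:V}; rewrite /char_polyf.
move: (vbasis _) bV => Y bY.
have PQ : mxof Y X \1%VF *m mxof X Y \1%VF = 1%:M.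
  by rewrite -mxof_comp // comp_lfun1l mxof1 // (basis_free bY).
have -> : mxof Y Y f = mxof Y X \1%VF *m mxof X X f *m mxof X Y \1%VF.
  by rewrite -!mxof_comp // comp_lfun1l comp_lfun1r.
move: (mxof Y X _) (mxof X Y _) (mxof X X f) PQ => P Q A PQ.
rewrite /char_poly /char_poly_mx !map_mxM /=.
have := congr1 (map_mx polyC) PQ; rewrite map_mxM map_mx1.
move: (map_mx _ P) (map_mx _ Q) (map_mx _ A) => P' Q' A' PQ'.
have -> : 'X%:M - P' *m A' *m Q' = P' *m ('X%:M - A') *m Q'.
  by rewrite mulmxBr mulmxBl mul_mx_scalar -scalemxAl PQ' scalemx1.
by rewrite !det_mulmx mulrAC -det_mulmx PQ' det1 mul1r.
Qed.

Lemma char_polyf_monic f : char_polyf f \is monic.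
Proof. exact: char_poly_monic. Qed.

Lemma root_factorization (p : {poly K}) : p \is monic ->
  exists s q, [/\ p = \prod_(a <- s) ('X - a%:P) * q, q \is monic &
                  forall a, ~~ root q a].
Proof.
have [n] := ubnP (size p); elim: n p => // n IHn p /ltnSE-le_pn p_mon.
have [[a /factor_theorem[q def_p]]|nroot] := pselect (exists a, root p a).
  have q_mon : q \is monic by rewrite def_p monicMr ?monicXsubC in p_mon.
  have [|s [r [def_q r_mon r_nroot]]] := IHn q _ q_mon.
    by move: le_pn; rewrite def_p size_Mmonic ?monic_neq0 ?monicXsubC //
                            size_XsubC addn2.
  exists (a :: s), r; split=> //.
  by rewrite big_cons def_p {1}def_q mulrC mulrA.
exists [::], p; split=> //; first by rewrite big_nil mul1r.
by move=> a; apply/negP => pa; apply: nroot; exists a.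
Qed.

Lemma mup_root_factorization s (q : {poly K}) a : ~~ root q a ->
  mup a (\prod_(c <- s) ('X - c%:P) * q) = count_mem a s.
Proof. by move=> qa; rewrite mupMl // mu_prod_XsubC. Qed.

Lemma ex_Spec f :
  exists A : {mset K}%mset, forall a, A a = mup a (char_polyf f).
Proof.
have [s [q [-> _ q_nroot]]] := root_factorization (char_polyf_monic f).
by exists (seq_mset s) => a; rewrite mset_seqE mup_root_factorization.
Qed.

(* The multiset of eigenvalues in the ground field, with their algebraic
   multiplicities.  Eigenvalues in proper extensions of [K] are not recorded,
   but there are none when [Spec f] has [\dim {:V}] elements, since the
   characteristic polynomial then splits over [K] ([char_polyf_split]). *)
Definition Spec f : {mset K}%mset := sval (cid (ex_Spec f)).

Lemma SpecE f a : Spec f a = mup a (char_polyf f).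
Proof. exact: (svalP (cid (ex_Spec f))). Qed.

Lemma mem_Spec f a : (a \in Spec f) = leigenvalue f a.
Proof.
rewrite in_mset SpecE -XsubC_dvd ?monic_neq0 ?char_polyf_monic //.
rewrite dvdp_XsubCl -eigenvalue_root_char /leigenvalue.
rewrite (leigenspaceE (vbasisP {:V})) /eigenvalue.
by rewrite (vsof_eq0 (vbasisP {:V})).
Qed.

Lemma char_polyf_split f : size (Spec f) = \dim {:V} ->
  char_polyf f = \prod_(a <- Spec f) ('X - a%:P).
Proof.
have [s [q [def_p q_mon q_nroot]]] := root_factorization (char_polyf_monic f).
have Ss : perm_eq (Spec f) s.
  have -> : Spec f = seq_mset s.
    apply/msetP => a.
    by rewrite SpecE def_p mup_root_factorization // mset_seqE.
  exact: perm_eq_seq_mset.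
rewrite (perm_size Ss) (perm_big _ Ss) /= => sz_s.
have := size_char_poly (mxof (vbasis {:V}) (vbasis {:V}) f).
rewrite -/(char_polyf f) def_p size_monicM ?monic_prod_XsubC ?monic_neq0 //.
rewrite size_prod_XsubC sz_s addSn /= -addn1 => /addnI sz_q.
have /size_poly1P[c _ def_q] : size q == 1%N by apply/eqP.
by move: q_mon; rewrite def_q monicE lead_coefC => /eqP->; rewrite mulr1.
Qed.

End Spectrum.

(* The Grassmannian geometry G_2(m); 'I_m = {0, ..., m-1} plays the role of
   {1, ..., m}. *)
Section Geometry.
Variable m : nat.

Definition point := {p : {set 'I_m} | #|p| == 2%N}.

(* Meaningful for pairwise distinct [i], [j], [k] only. *)
Definition blk (i j k : 'I_m) : {set point} :=
  [set p : point | val p \in [:: [set i; j]; [set i; k]; [set j; k]]].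

Definition blocks : {set {set point}} :=
  [set b | [exists i, exists j, exists k,
              [&& i != j, i != k, j != k & b == blk i j k]]].

Definition supp (b : {set point}) : {set 'I_m} := \bigcup_(p in b) val p.

(* A decoration is represented by a function on all sets of points; its values
   outside [blocks] are never used. *)
Definition is_decoration (delta : {set point} -> int) : Prop :=
  {in blocks, forall b, delta b = 1 \/ delta b = -1}.

Definition kappa (delta : {set point} -> int) (i j k r : 'I_m) : int :=
  delta (blk i j k) * delta (blk i j r) * delta (blk i k r) *
  delta (blk j k r).

Lemma pt_subproof (i j : 'I_m) : i != j -> #|[set i; j]| == 2%N.
Proof. by rewrite cards2 => ->. Qed.

Definition pt (i j : 'I_m) (ij : i != j) : point :=
  exist _ [set i; j] (pt_subproof ij).

Lemma pt_eqE (i j k l : 'I_m) (ij : i != j) (kl : k != l) :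
  (pt ij == pt kl) = ([set i; j] == [set k; l]).
Proof. by rewrite -val_eqE. Qed.

Lemma blkE (i j k : 'I_m) (ij : i != j) (ik : i != k) (jk : j != k) :
  blk i j k = [set pt ij; pt ik; pt jk].
Proof. by apply/setP => p; rewrite !inE -!val_eqE /= orbA. Qed.

Lemma supp_blk (i j k : 'I_m) : i != j -> i != k -> j != k ->
  supp (blk i j k) = [set i; j; k].
Proof.
move=> ij ik jk; rewrite (blkE ij ik jk) /supp !bigcup_setU !big_set1 /=.
apply/setP => x; rewrite !inE.
by case: (x == i) (x == j) (x == k) => [] [] [].
Qed.

Lemma card_blk (i j k : 'I_m) : i != j -> i != k -> j != k ->
  #|blk i j k| = 3%N.
Proof.
move=> ij ik jk; rewrite (blkE ij ik jk) setUC cardsU1 cards2 !inE.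
rewrite !pt_eqE !eqEsubset !subUset !sub1set !inE.
by rewrite !eqxx !orbT /= !(eq_sym k) !(eq_sym j i) (negPf ij) (negPf ik)
           (negPf jk).
Qed.

Lemma blk_in_blocks (i j k : 'I_m) : i != j -> i != k -> j != k ->
  blk i j k \in blocks.
Proof.
move=> ij ik jk; rewrite inE; apply/existsP; exists i; apply/existsP; exists j.
by apply/existsP; exists k; rewrite ij ik jk eqxx.
Qed.

Lemma blocksP b : reflect
  (exists i j k, [/\ i != j, i != k, j != k & b = blk i j k]) (b \in blocks).
Proof.
rewrite inE; apply: (iffP existsP) => [[i]|[i [j [k [ij ik jk ->]]]]].
  case/existsP=> j /existsP[k /and4P[ij ik jk /eqP->]].
  by exists i, j, k.
exists i; apply/existsP; exists j; apply/existsP; exists k.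
by rewrite ij ik jk eqxx.
Qed.

Lemma in_blk (i j k : 'I_m) (p : point) : i != j -> i != k -> j != k ->
  (p \in blk i j k) = (val p \subset [set i; j; k]).
Proof.
move=> ij ik jk; rewrite !inE; apply/idP/idP.
  by case/or3P=> /eqP->; rewrite subUset !sub1set !inE !eqxx ?orbT.
have /cards2P[x [y [xy ->]]] := valP p.
rewrite subUset !sub1set !inE => /andP[].
case/orP=> [/orP[]|] /eqP ex; case/orP=> [/orP[]|] /eqP ey;
  move: xy; rewrite ex ey ?eqxx // => _; apply/or3P;
  first [ by constructor 1 | by constructor 1; rewrite setUC
        | by constructor 2 | by constructor 2; rewrite setUC
        | by constructor 3 | by constructor 3; rewrite setUC ].
Qed.

Lemma blocks_suppE b : b \in blocks ->
  #|supp b| = 3%N /\ b = [set p : point | val p \subset supp b].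
Proof.
case/blocksP=> i [j [k [ij ik jk ->]]]; rewrite supp_blk //; split.
  by rewrite setUC cardsU1 cards2 !inE ij !(eq_sym k) negb_or ik jk.
by apply/setP => p; rewrite in_blk // inE.
Qed.

End Geometry.

Section Algebra.
Variables (K : fieldType) (m : nat) (delta : {set point m} -> int).

Definition incalg : vectType K := {ffun point m -> K^o}.

Lemma dim_incalg : \dim {: incalg} = 'C(m, 2).
Proof.
rewrite dimvf /dim /= card_sig muln1 -[in RHS](card_ord m) -card_draws.
by rewrite cardsE; apply: eq_card => p; rewrite !inE.
Qed.

Definition evec (p : point m) : incalg := [ffun q => (q == p)%:R].

(* The coefficient of [evec s] in the product of [evec p] and [evec q]: it is
   nonzero only when [p], [q], [s] are the three points of a block (so that
   they are distinct); see [dmul_evec] and [dmul_evec0]. *)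
Definition dcoef (p q s : point m) : K :=
  if [set p; q; s] \in blocks m then (delta [set p; q; s])%:~R else 0.

Definition dmul (x y : incalg) : incalg :=
  [ffun s => \sum_p \sum_q x p * y q * dcoef p q s].

Fact dmul_is_linear x : linear (dmul x).
Proof.
move=> a y z; apply/ffunP => s; rewrite !ffunE scaler_sumr -big_split /=.
apply: eq_bigr => p _; rewrite scaler_sumr -big_split /=.
apply: eq_bigr => q _; rewrite !ffunE /= -[a *: (y q)]/(a * y q).
by rewrite mulrDr mulrDl mulrCA -!mulrA.
Qed.

HB.instance Definition _ x :=
  GRing.isLinear.Build K incalg incalg *:%R (dmul x) (dmul_is_linear x).

Lemma dmulC x y : dmul x y = dmul y x.
Proof.
apply/ffunP => s; rewrite !ffunE exchange_big; apply: eq_bigr => q _ /=.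
apply: eq_bigr => p _; rewrite [x p * _]mulrC /dcoef.
by rewrite [[set p; q]]setUC.
Qed.

Lemma dmul_evecE p q s : dmul (evec p) (evec q) s = dcoef p q s.
Proof.
rewrite ffunE (bigD1 p) //= (bigD1 q) //= !ffunE !eqxx !mul1r.
rewrite big1 => [|t /negPf tq]; last by rewrite !ffunE tq mulr0 mul0r.
rewrite big1 ?addr0 // => t /negPf tp; rewrite big1 // => u _.
by rewrite !ffunE tp !mul0r.
Qed.

Lemma dmul_evec (i j k : 'I_m) (ij : i != j) (ik : i != k) (jk : j != k) :
  dmul (evec (pt ij)) (evec (pt ik)) =
    (delta (blk i j k))%:~R *: evec (pt jk).
Proof.
apply/ffunP => s; rewrite dmul_evecE !ffunE /dcoef.
have [->|sjk] := eqVneq s (pt jk).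
  by rewrite -blkE blk_in_blocks // /GRing.scale /= mulr1.
rewrite scaler0; case: ifP => // bP.
have [i0 [j0 [k0 [d1 d2 d3 def_b]]]] := blocksP _ bP.
have c3 := card_blk d1 d2 d3.
have [sc def_b'] := blocks_suppE bP.
have supE : supp [set pt ij; pt ik; s] = [set i; j; k].
  apply/esym/eqP; rewrite eqEcard sc.
  rewrite (_ : #|_| = 3%N) ?leqnn ?andbT; last first.
    by rewrite setUC cardsU1 cards2 !inE ij !(eq_sym k) negb_or ik jk.
  rewrite /supp !bigcup_setU !big_set1 /=; apply/subsetP => x.
  by rewrite !inE => /orP[/orP[]|] ->; rewrite ?orbT.
have sb : s \in [set pt ij; pt ik; s] by rewrite !inE eqxx orbT.
have : s \in blk i j k.
  by rewrite in_blk // -supE; rewrite {1}def_b' inE in sb.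
rewrite (blkE ij ik jk) !inE (negPf sjk) orbF => sP.
move: c3; rewrite -def_b setUC cardsU1 !inE sP add0n cards2.
by case: (_ != _).
Qed.

Lemma dmul_evec0 (p q : point m) : p = q \/ [disjoint val p & val q] ->
  dmul (evec p) (evec q) = 0.
Proof.
move=> pq; apply/ffunP => s; rewrite dmul_evecE !ffunE /dcoef.
case: ifP => // bP; case: pq => [epq|dis].
  have [i [j [k [ij ik jk def_b]]]] := blocksP _ bP.
  have := card_blk ij ik jk; rewrite -def_b epq setUid cards2.
  by case: (_ != _).
have [sc _] := blocks_suppE bP.
have : (#|val p :|: val q| <= 3)%N.
  by rewrite -sc subset_leq_card // /supp !bigcup_setU !big_set1 subsetUl.
rewrite cardsU (disjoint_setI0 dis) cards0 subn0.
by rewrite (eqP (valP p)) (eqP (valP q)).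
Qed.

Definition Lmul (c : incalg) : 'End(incalg) := linfun (dmul c).

Lemma LmulE c x : Lmul c x = dmul c x.
Proof. by rewrite lfunE. Qed.

Definition block_idem (b : {set point m}) : incalg :=
  (2^-1 * (delta b)%:~R) *: \sum_(p in b) evec p.

End Algebra.

Definition sigma (K : fieldType) (m k : nat) : {mset K}%mset :=
  (msetn 'C(m - 3, 2) (0 : K) `+` msetn (m - 2 - k)%N (1 : K)
     `+` msetn k (- 1 : K)
     `+` msetn (2 * (m - 2 - k))%N (- 2^-1 : K)
     `+` msetn (2 * k)%N (2^-1 : K))%mset.

(* Main.v *)
(* The operator L preserves the span of [e_ij, e_ik, e_jk] and, for each r
   outside the support, the span of [e_ir, e_jr, e_kr], and it kills every e_p
   with p disjoint from {i, j, k}.  On the first span its matrix is half the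
   adjacency matrix of a triangle, and on the others half that of a triangle
   with signed edges, whose product of signs is kappa.  Flipping the signs of
   basis vectors turns such a triangle into kappa times the unsigned one,
   half of which has eigenvalues 1, -1/2, -1/2.  The eigenvectors obtained span the algebra
   and there are as many of them as its dimension. *)
Require Import Defs.
From mathcomp Require Import all_boot all_order all_algebra.
From mathcomp Require Import finmap multiset.
From mathcomp Require Import zify.

Set Implicit Arguments.
Unset Strict Implicit.
Unset Printing Implicit Defensive.

Import GRing.Theory passmx.
Local Open Scope ring_scope.

(** * Spectra from spanning lists of eigenvectors, and the triangle pattern *)

Section Eigenpairs.
Variables (K : fieldType) (V : vectType K).
Implicit Types (f : 'End(V)) (s : seq (V * K)) (u v w : V) (mu : K).

Definition eigenpairs f s := {in s, forall p, f p.1 = p.2 *: p.1}.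

(** A spanning list of [\dim {:V}] vectors is a basis. In it [f] is diagonal, so the characteristic
    polynomial is the product of the factors ['X - mu] over the list. *)
Lemma Spec_eigenpairs f s a : eigenpairs f s ->
  <<unzip1 s>>%VS = fullv -> size s = \dim {:V} ->
  Spec f a = count_mem a (unzip2 s).
Proof.
move=> fs span_s sz_s; rewrite SpecE.
have sz1 : size (unzip1 s) == \dim {:V} by rewrite size_map sz_s.
pose X := Tuple sz1.
have bX : basis_of {:V} X by rewrite basisEdim span_s subvv (eqP sz1) leqnn.
rewrite (char_polyf_basis _ bX).
pose d : 'rV[K]_(\dim {:V}) := \row_i (nth (0, 0) s i).2.
have -> : mxof X X f = diag_mx d.
  (* Row [i] holds the coordinates of the image of the [i]-th basis vector, which is a multiple of
     that vector. *)
  apply/row_matrixP => i; rewrite !rowE mul_mxof.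
  have lt_i : (i < size s)%N by rewrite sz_s.
  have Xi : X`_i = (nth (0, 0) s i).1 by rewrite /= (nth_map (0, 0)).
  rewrite -(rVofE bX) rVofK // Xi fs ?mem_nth // -Xi.
  rewrite linearZ /= rVofE //; apply/rowP => j.
  rewrite mul_mx_diag !mxE eqxx /= mulrC.
  by case: eqVneq => [->|]; rewrite ?mul0r.
rewrite char_poly_trig ?diag_mx_is_trig // -mu_prod_XsubC; congr (mup _ _).
rewrite big_map (big_nth (0, 0)) big_mkord sz_s.
by apply: eq_bigr => i _; rewrite !mxE eqxx mulr1n.
Qed.

(** Eigenvectors of [mu] times the adjacency matrix of a triangle: the all-one vector, and two
    differences generating the vectors of coordinate sum zero. *)
Definition triangle_pairs u v w mu : seq (V * K) :=
  [:: (u + v + w, mu + mu); (u - v, - mu); (u - w, - mu)].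

Lemma triangle_eigenpairs f u v w mu :
    f u = mu *: (v + w) -> f v = mu *: (u + w) -> f w = mu *: (u + v) ->
  eigenpairs f (triangle_pairs u v w mu).
Proof.
move=> fu fv fw p; rewrite !inE => /or3P[] /eqP-> /=.
- rewrite 2!linearD /= fu fv fw scalerDl -!scalerDr; congr (_ *: _).
  by rewrite [LHS](AC ((2*2)*2) ((3*1*2)*(5*6*4))).
- rewrite linearB /= fu fv -scalerBr scaleNr -scalerN; congr (_ *: _).
  by rewrite [u + w]addrC addrKA opprB.
- rewrite linearB /= fu fw -scalerBr scaleNr -scalerN; congr (_ *: _).
  by rewrite [v + w]addrC [u + v]addrC addrKA opprB.
Qed.

(** The three eigenvectors add up to [3 u]; dividing by 3 gives [u], and the differences then give
    [v] and [w]. *)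
Lemma triangle_span u v w mu (U : {vspace V}) : 3%:R != 0 :> K ->
    {subset unzip1 (triangle_pairs u v w mu) <= U} ->
  [/\ u \in U, v \in U & w \in U].
Proof.
move=> nz3 sU.
have Us : u + v + w \in U by apply: sU; rewrite !inE eqxx.
have Uuv : u - v \in U by apply: sU; rewrite !inE eqxx orbT.
have Uuw : u - w \in U by apply: sU; rewrite !inE eqxx !orbT.
have Uu : u \in U.
  have: 3%:R *: u \in U.
    have -> : 3%:R *: u = u + v + w + (u - v) + (u - w).
      rewrite scaler_nat (AC (3*2*2) ((1*4*6)*(2*5)*(3*7))) /= !subrr !addr0.
      by rewrite !mulrS mulr0n addr0 addrA.
    by apply: memvD => //; apply: memvD.
  by rewrite rpredZeq (negPf nz3).
split=> //.
  by rewrite -[v](subKr u) memvB.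
by rewrite -[w](subKr u) memvB.
Qed.

End Eigenpairs.

(** * The action of a block idempotent on the basis vectors *)

Section PairVectors.
Variables (K : fieldType) (m : nat) (delta : {set point m} -> int).
Implicit Types (x y z t i j k r : 'I_m).

(* [evec (pt xy)] without the proof that [x != y], and [0] when [x = y]. *)
Definition epair x y : incalg K m :=
  [ffun q : point m => (val q == [set x; y])%:R].

Lemma epairE x y (xy : x != y) : epair x y = evec K (pt xy).
Proof. by apply/ffunP => q; rewrite !ffunE -val_eqE. Qed.

Lemma epairC x y : epair x y = epair y x.
Proof. by rewrite /epair setUC. Qed.

Lemma blkC12 x y z : blk x y z = blk y x z.
Proof.
by apply/setP => p; rewrite !inE [[set y; x]]setUC; congr (_ || _); exact: orbC.
Qed.

Lemma blkC23 x y z : blk x y z = blk x z y.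
Proof. by apply/setP => p; rewrite !inE [[set z; y]]setUC orbCA. Qed.

Lemma dmul_epair x y z : x != y -> x != z -> y != z ->
  dmul delta (epair x y) (epair x z) = (delta (blk x y z))%:~R *: epair y z.
Proof. by move=> xy xz yz; rewrite !epairE dmul_evec. Qed.

Lemma dmul_epair_self x y : x != y ->
  dmul delta (epair x y) (epair x y) = 0.
Proof. by move=> xy; rewrite epairE dmul_evec0 //; left. Qed.

Lemma dmul_epair_evec x y (p : point m) :
  x != y -> x \notin val p -> y \notin val p ->
  dmul delta (epair x y) (evec K p) = 0.
Proof.
move=> xy xp yp; rewrite epairE dmul_evec0 //; right.
by rewrite disjoints_subset subUset !sub1set !inE xp.
Qed.

Lemma dmul_epair_disjoint x y z t : uniq [:: x; y; z; t] ->
  dmul delta (epair x y) (epair z t) = 0.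
Proof.
rewrite /= !inE !negb_or andbT => /and3P[/and3P[xy xz xt] /andP[yz yt] zt].
by rewrite (epairE zt) dmul_epair_evec //= !inE negb_or ?xz ?yz.
Qed.

Lemma block_idemE i j k : i != j -> i != k -> j != k ->
  block_idem K delta (blk i j k) =
    (2^-1 * (delta (blk i j k))%:~R) *: (epair i j + epair i k + epair j k).
Proof.
move=> ij ik jk; rewrite /block_idem; congr (_ *: _).
(* Cardinality 3 forces the three points to be distinct, so the sum over the set splits into three
   terms. *)
have := card_blk ij ik jk; rewrite !epairE (blkE ij ik jk) -setUA.
rewrite cardsU1 cards2.
case ijP: (_ \notin _) => //; case ikP: (_ != _) => // _.
by rewrite big_setU1 ?ijP //= big_setU1 ?big_set1 ?addrA // inE.
Qed.

Definition sgn x y z : K := (delta (blk x y z))%:~R.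

Lemma sgnC12 x y z : sgn x y z = sgn y x z.
Proof. by rewrite /sgn blkC12. Qed.

Lemma sgnC23 x y z : sgn x y z = sgn x z y.
Proof. by rewrite /sgn blkC23. Qed.

Lemma Lmul_block_idem i j k (v : incalg K m) : i != j -> i != k -> j != k ->
  Lmul delta (block_idem K delta (blk i j k)) v =
  (2^-1 * sgn i j k) *: (dmul delta (epair i j) v + dmul delta (epair i k) v
                         + dmul delta (epair j k) v).
Proof.
move=> ij ik jk; rewrite LmulE dmulC block_idemE // linearZ; congr (_ *: _).
by rewrite 2!linearD /= !(dmulC delta v).
Qed.

Hypothesis delta_dec : is_decoration delta.

Lemma sgnP x y z : x != y -> x != z -> y != z ->
  sgn x y z = 1 \/ sgn x y z = -1.
Proof.
move=> xy xz yz; rewrite /sgn.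
by case: (delta_dec (blk_in_blocks xy xz yz)) => ->; [left | right].
Qed.

(** Both nonzero products carry the sign of the block, which cancels against the same sign in the
    idempotent. *)
Lemma Lmul_block_inner i j k : i != j -> i != k -> j != k ->
  Lmul delta (block_idem K delta (blk i j k)) (epair i j) =
  2^-1 *: (epair i k + epair j k).
Proof.
move=> ij ik jk; rewrite Lmul_block_idem // dmul_epair_self // add0r.
rewrite dmul_epair // 1?eq_sym // (epairC i j) dmul_epair // 1?eq_sym //.
rewrite -/(sgn _ _ _) -/(sgn _ _ _) /sgn (blkC23 i k) (blkC23 j k) (blkC12 j i).
rewrite -/(sgn i j k) -scalerDr scalerA -mulrA (epairC k j) (epairC k i) addrC.
by case: (sgnP ij ik jk) => ->; rewrite ?mulrNN !mulr1 addrC.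
Qed.

(** Among the points of the block only [ij] and [ik] meet [ir]; the point [jk] is disjoint from it
    and contributes 0. *)
Lemma Lmul_block_mixed i j k r : uniq [:: i; j; k; r] ->
  Lmul delta (block_idem K delta (blk i j k)) (epair i r) =
  2^-1 *: ((sgn i j k * sgn i j r) *: epair j r
           + (sgn i j k * sgn i k r) *: epair k r).
Proof.
move=> u4; have := u4; rewrite /= !inE !negb_or andbT.
move=> /and3P[/and3P[ij ik ir] /andP[jk jr] kr].
rewrite Lmul_block_idem // !dmul_epair // dmul_epair_disjoint; last first.
  by rewrite /= !inE !negb_or jk jr kr !(eq_sym _ i) ij ik ir.
by rewrite addr0 -!scalerA -scalerDr.
Qed.

Lemma block_triangle_eigenpairs i j k : i != j -> i != k -> j != k ->
  eigenpairs (Lmul delta (block_idem K delta (blk i j k)))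
    (triangle_pairs (epair i j) (epair i k) (epair j k) 2^-1).
Proof.
move=> ij ik jk; apply: triangle_eigenpairs.
- exact: Lmul_block_inner.
- by rewrite blkC23 Lmul_block_inner 1?(eq_sym k) // (epairC k j).
- rewrite blkC12 blkC23 Lmul_block_inner 1?(eq_sym _ i) //.
  by rewrite (epairC j i) (epairC k i).
Qed.

Lemma kappaE i j k r : (kappa delta i j k r)%:~R =
  sgn i j k * sgn i j r * sgn i k r * sgn j k r.
Proof. by rewrite /kappa !intrM. Qed.

Lemma kappaP i j k r : uniq [:: i; j; k; r] ->
  kappa delta i j k r = 1 \/ kappa delta i j k r = -1.
Proof.
rewrite /= !inE !negb_or andbT.
move=> /and3P[/and3P[ij ik ir] /andP[jk jr] kr]; rewrite /kappa.
case: (delta_dec (blk_in_blocks ij ik jk)) => ->;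
case: (delta_dec (blk_in_blocks ij ir jr)) => ->;
case: (delta_dec (blk_in_blocks ik ir kr)) => ->;
by case: (delta_dec (blk_in_blocks jk jr kr)) => ->; first [by left | by right].
Qed.

(* The coefficients rescale the signed triangle on [ir, jr, kr] to the
   unsigned one, up to the global sign [kappa]. *)
Lemma mixed_triangle_eigenpairs i j k r : uniq [:: i; j; k; r] ->
  eigenpairs (Lmul delta (block_idem K delta (blk i j k)))
    (triangle_pairs (epair i r) ((sgn i k r * sgn j k r) *: epair j r)
       ((sgn i j r * sgn j k r) *: epair k r)
       (2^-1 * (kappa delta i j k r)%:~R)).
Proof.
move=> u4; have := u4; rewrite /= !inE !negb_or andbT.
move=> /and3P[/and3P[ij ik ir] /andP[jk jr] kr].
(* [Lj] and [Lk] are [Lmul_block_mixed] with [j], respectively [k], in the role of [i]. *)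
have Lj : Lmul delta (block_idem K delta (blk i j k)) (epair j r) =
    2^-1 *: ((sgn i j k * sgn i j r) *: epair i r
             + (sgn i j k * sgn j k r) *: epair k r).
  rewrite (blkC12 i j) Lmul_block_mixed ?(sgnC12 j i) //.
  by rewrite /= !inE !negb_or !(eq_sym j i) ij ik ir jk jr kr.
have Lk : Lmul delta (block_idem K delta (blk i j k)) (epair k r) =
    2^-1 *: ((sgn i j k * sgn i k r) *: epair i r
             + (sgn i j k * sgn j k r) *: epair j r).
  rewrite (blkC23 i j) (blkC12 i k) Lmul_block_mixed.
    by rewrite (sgnC12 k i j) (sgnC23 i k j) (sgnC12 k i) (sgnC12 k j).
  by rewrite /= !inE !negb_or !(eq_sym k i) !(eq_sym k j) ij ik ir jk jr kr.
(* Once one half is factored out, comparing coefficients leaves identities between products of four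
   signs, checked case by case. *)
move: (sgnP ij ik jk) (sgnP ij ir jr) (sgnP ik ir kr) (sgnP jk jr kr).
rewrite kappaE => Ed EA EB EC; apply: triangle_eigenpairs.
- rewrite (Lmul_block_mixed u4) -(scalerA 2^-1); congr (_ *: _).
 rewrite scalerDr !scalerA; congr (_ *: _ + _ *: _);
  by case: Ed EA EB EC => -> [] -> [] -> [] ->; rewrite ?(mulrN, mulr1, opprK).
- rewrite linearZ /= Lj scalerA mulrC -!(scalerA 2^-1); congr (_ *: _).
  rewrite !scalerDr !scalerA; congr (_ *: _ + _ *: _);
  by case: Ed EA EB EC => -> [] -> [] -> [] ->; rewrite ?(mulrN, mulr1, opprK).
- rewrite linearZ /= Lk scalerA mulrC -!(scalerA 2^-1); congr (_ *: _).
  rewrite !scalerDr !scalerA; congr (_ *: _ + _ *: _);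
  by case: Ed EA EB EC => -> [] -> [] -> [] ->; rewrite ?(mulrN, mulr1, opprK).
Qed.

End PairVectors.

(** * An explicit eigenbasis *)

Section Spectrum.
Variables (K : fieldType) (m : nat) (delta : {set point m} -> int).
Hypothesis charK0 : [pchar K] =i pred0.
Hypothesis delta_dec : is_decoration delta.
Variables i j k : 'I_m.
Hypotheses (ij : i != j) (ik : i != k) (jk : j != k).

Local Notation sg := (sgn K delta).
Local Notation ep := (@epair K m).
Let R : {set 'I_m} := ~: [set i; j; k].
Let L := Lmul delta (block_idem K delta (blk i j k)).

Definition mixed_pairs r : seq (incalg K m * K) :=
  triangle_pairs (ep i r) ((sg i k r * sg j k r) *: ep j r)
    ((sg i j r * sg j k r) *: ep k r)
    (2^-1 * (kappa delta i j k r)%:~R).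

Definition outer_pairs : seq (incalg K m * K) :=
  [seq (evec K p, 0) | p <- enum [set p : point m | val p \subset R]].

(** The three pieces correspond to the points sharing two, one or no elements with [{i, j, k}]. *)
Definition spectral_pairs : seq (incalg K m * K) :=
  triangle_pairs (ep i j) (ep i k) (ep j k) 2^-1 ++
  flatten [seq mixed_pairs r | r <- enum R] ++ outer_pairs.

Lemma uniq_ijkr r : r \in R -> uniq [:: i; j; k; r].
Proof.
rewrite /= !inE !negb_or ij ik jk /= andbT !(eq_sym r).
by case/andP=> /andP[-> ->] ->.
Qed.

Lemma card_outside : #|R| = (m - 3)%N.
Proof.
rewrite cardsCs setCK card_ord setUC cardsU1 cards2 !inE negb_or.
by rewrite !(eq_sym k) ij ik jk.
Qed.

(** Since [kappa] takes only the values 1 and -1 on [R], the two sets partition [R]. *)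
Lemma card_kappa :
  (m - 3)%N = addn #|[set r in R | kappa delta i j k r == 1]|
                   #|[set r in R | kappa delta i j k r == -1]|.
Proof.
rewrite -card_outside -(cardsID [set r | kappa delta i j k r == 1] R).
congr (_ + _)%N; apply: eq_card => r; rewrite !inE //.
rewrite andbC; apply: andb_id2l => rR.
have /uniq_ijkr/kappaP : r \in R by rewrite !inE.
by case/(_ _ delta_dec) => ->.
Qed.

Lemma card_outer_points : #|[set p : point m | val p \subset R]| = 'C(m - 3, 2).
Proof.
rewrite -(card_imset _ val_inj).
have -> : val @: [set p : point m | val p \subset R] =
          [set A : {set 'I_m} | (A \subset R) && (#|A| == 2%N)].
  apply/setP => A; rewrite inE; apply/idP/idP => [/imsetP[p]|/andP[AR A2]].
    by rewrite inE => pR ->; rewrite pR; exact: (valP p).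
  by apply/imsetP; exists (exist _ A A2); rewrite ?inE.
by rewrite cards_draws card_outside.
Qed.

Lemma spectral_pairsP : eigenpairs L spectral_pairs.
Proof.
move=> p; rewrite !mem_cat => /or3P[].
- exact: block_triangle_eigenpairs.
- case/flatten_mapP=> r; rewrite mem_enum => rR.
  exact/mixed_triangle_eigenpairs/uniq_ijkr.
case/mapP=> q; rewrite mem_enum inE => qR -> /=.
(* A point inside [R] is disjoint from all three points of the block, so every product vanishes. *)
rewrite scale0r; have qT x : x \in [set i; j; k] -> x \notin val q.
  by apply: contraL => /(subsetP qR); rewrite inE.
have [qi qj qk] : [/\ i \notin val q, j \notin val q & k \notin val q].
  by split; apply: qT; rewrite !inE eqxx ?orbT.
by rewrite Lmul_block_idem // !dmul_epair_evec // !addr0 scaler0.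
Qed.

(** Sorting the points by their intersection with [{i, j, k}] gives ['C(m, 2) = 3 + 3 * (m - 3) +
    'C(m - 3, 2)]. *)
Lemma size_spectral_pairs : (3 <= m)%N ->
  size spectral_pairs = \dim {:incalg K m}.
Proof.
move=> m_ge3; rewrite dim_incalg !size_cat size_flatten size_map -cardE.
have -> : sumn (shape [seq mixed_pairs r | r <- enum R]) = (3 * (m - 3))%N.
  rewrite /shape -map_comp sumnE big_map big_enum /= sum_nat_const.
  by rewrite card_outside mulnC.
rewrite card_outer_points -[in RHS](subnKC m_ge3).
by rewrite !binS !bin1 !bin0 /=; lia.
Qed.

(** By [triangle_span] each triangle recovers its three basis vectors, and every point lies in a
    triangle or inside [R]. *)
Lemma span_spectral_pairs : <<unzip1 spectral_pairs>>%VS = fullv.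
Proof.
have /pcharf0P nat0 := charK0.
have nz3 : 3%:R != 0 :> K by rewrite nat0.
apply/eqP; rewrite eqEsubv subvf /=.
set U := <<_>>%VS.
have memU p : p \in spectral_pairs -> p.1 \in U.
  by move=> p_s; apply: memv_span; exact: (map_f fst p_s).
have subU s : {subset s <= spectral_pairs} -> {subset unzip1 s <= U}.
  by move=> ss v /mapP[p /ss p_s ->]; apply: memU.
have [Uij Uik Ujk] : [/\ ep i j \in U, ep i k \in U & ep j k \in U].
  apply: (triangle_span (mu := 2^-1)) => //; apply: subU => p.
  by rewrite !mem_cat => ->.
have Ur r : r \in R -> [/\ ep i r \in U, ep j r \in U & ep k r \in U].
  move=> rR; have := uniq_ijkr rR; rewrite /= !inE !negb_or andbT.
  move=> /and3P[/and3P[_ _ ir] /andP[_ jr] kr].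
  have [] : [/\ ep i r \in U, (sg i k r * sg j k r) *: ep j r \in U
              & (sg i j r * sg j k r) *: ep k r \in U].
    apply: (triangle_span (mu := 2^-1 * (kappa delta i j k r)%:~R)) => //.
    apply: subU => p pr; rewrite !mem_cat; apply/or3P; constructor 2.
    by apply/flatten_mapP; exists r; rewrite ?mem_enum.
  (* The rescaling coefficients are products of signs, hence nonzero, and can be removed. *)
  rewrite !rpredZeq !mulf_eq0 => ->.
  have nz x y z : x != y -> x != z -> y != z -> (sg x y z == 0) = false.
    move=> xy xz yz; case: (sgnP K delta_dec xy xz yz) => ->;
    by rewrite ?oppr_eq0 oner_eq0.
  by rewrite !nz.
have Uev p : evec K p \in U.
  have [] := boolP (val p \subset R) => [pR|].
    apply: (memU (evec K p, 0)).
    rewrite !mem_cat; apply/or3P; constructor 3.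
    by apply/mapP; exists p; rewrite // mem_enum inE.
  have /cards2P[x [y [xy def_p]]] := valP p.
  have -> : evec K p = ep x y.
    by rewrite (epairE _ xy); congr evec; apply: val_inj.
  rewrite def_p subUset !sub1set.
  (* A point not inside [R] has an element among [i], [j], [k]; by symmetry of the pair it is
     [x]. *)
  wlog: x y xy {def_p} / x \notin R => [IH | xR _].
    rewrite negb_and => /orP[] nR; last rewrite epairC; apply: IH;
    by rewrite // 1?eq_sym // negb_and nR ?orbT.
  have [yR|yR] := boolP (y \in R).
    have [] := Ur y yR; move: xR; rewrite !inE negbK.
    by case/orP=> [/orP[]|] /eqP->.
  move: xR yR; rewrite !inE !negbK.
  case/orP=> [/orP[]|] /eqP xE; case/orP=> [/orP[]|] /eqP yE;
    by move: xy; rewrite xE yE ?eqxx // 1?epairC.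
apply/subvP => x _.
have -> : x = \sum_p x p *: evec K p.
  apply/ffunP => q; rewrite sum_ffunE.
  transitivity (\sum_p x p * (q == p)%:R).
    rewrite (bigD1 q) // eqxx mulr1 big1 => [|p /negPf pq].
      exact/esym/addr0.
    by rewrite eq_sym pq mulr0.
  by apply: eq_bigr => p _; rewrite ffunE [evec K p q]ffunE.
by apply: memv_suml => p _; apply: memvZ.
Qed.

(** * Counting multiplicities, with equality tests read as 0 or 1 *)

Lemma count_triangle_pairs (V : vectType K) (u v w : V) (mu a : K) :
  count (preim snd (pred1 a)) (triangle_pairs u v w mu) =
    ((a == (mu + mu)%R) + 2 * (a == (- mu)%R))%N.
Proof. by rewrite /= !(eq_sym _ a) addn0 mul2n addnn. Qed.

Lemma count_outer_pairs (a : K) :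
  count (preim snd (pred1 a)) outer_pairs = ((a == 0%R) * 'C(m - 3, 2))%N.
Proof.
rewrite -card_outer_points cardE count_map eq_sym.
have [->|/negPf a0] := eqVneq 0 a.
  by rewrite mul1n -[RHS]count_predT; apply: eq_count => q /=; rewrite eqxx.
by rewrite mul0n -[RHS](count_pred0 (enum [set p : point m | val p \subset R]));
   apply: eq_count.
Qed.

Lemma Spec_block_idem : (3 <= m)%N ->
  Spec L = sigma K m #|[set r in R | kappa delta i j k r == -1]|.
Proof.
move=> m_ge3; apply/msetP => a.
rewrite (Spec_eigenpairs _ spectral_pairsP span_spectral_pairs);
  last exact: size_spectral_pairs.
rewrite count_map !count_cat count_flatten -map_comp sumnE big_map big_enum.
have nz2 : 2%:R != 0 :> K by have /pcharf0P -> := charK0.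
have half : 2^-1 + 2^-1 = 1 :> K by rewrite -mulr2n -(mulr_natl 2^-1) divff.
rewrite count_triangle_pairs count_outer_pairs half.
(* The triangle of [r] contributes [kappa] once and [- kappa / 2] twice, so the sum is split by the
   value of [kappa]. *)
rewrite (bigID (fun r => kappa delta i j k r == -1)) /=.
have cE e :
  \sum_(r in R | kappa delta i j k r == e)
     count (preim snd (pred1 a)) (mixed_pairs r) =
  (#|[set r in R | kappa delta i j k r == e]| *
     ((a == e%:~R) + 2 * (a == (- (2^-1 * e%:~R))%R)))%N.
  rewrite -sum_nat_const; apply: eq_big => [r|r /andP[_ /eqP kr]].
    by rewrite !inE.
  by rewrite count_triangle_pairs kr -mulrDl half mul1r.
rewrite cE.
rewrite (eq_bigl (fun r => (r \in R) && (kappa delta i j k r == 1))) => [|r];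
  last first.
  by apply: andb_id2l => /uniq_ijkr/(kappaP delta_dec)[] ->.
rewrite cE rmorphN1 mulrN1 mulr1z mulr1 opprK.
rewrite /sigma !msetE2 !msetnE.
have := card_kappa; move: #|_| #|_| => p q mpq.
(* Here [p] and [q] count the [r] with [kappa] equal to -1 and 1; the extra 1 is the triangle of the
   block itself. *)
have -> : (m - 2 - p)%N = q.+1 by lia.
case: (a == 0); case: (a == 1); case: (a == -1); case: (a == 2^-1);
  case: (a == - 2^-1); lia.
Qed.

End Spectrum.

(** A support has three elements, so the labels are distinct, and a block consists of all points
    inside its support. *)
Lemma block_of_supp m (b : {set point m}) (i j k : 'I_m) :
    b \in blocks m -> supp b = [set i; j; k] ->
  [/\ i != j, i != k, j != k & b = blk i j k].
Proof.
move=> /blocks_suppE[card3 bE] suppE.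
have [ij ik jk] : [/\ i != j, i != k & j != k].
  move: card3; rewrite suppE setUC cardsU1 cards2 !inE negb_or !(eq_sym k).
  by case: (i != j); case: (i != k); case: (j != k).
by split=> //; apply/setP => p; rewrite in_blk // bE inE suppE.
Qed.

Theorem theorem2p8 (K : fieldType) (charK0 : [pchar K] =i pred0)
    (m : nat) (m_ge3 : (3 <= m)%N)
    (delta : {set point m} -> int) (delta_dec : is_decoration delta)
    (b : {set point m}) (b_block : b \in blocks m)
    (i j k : 'I_m) (supp_b : supp b = [set i; j; k]) :
  let R : {set 'I_m} := ~: [set i; j; k] in
  let n : nat := #|[set r in R | kappa delta i j k r == -1]| in
  #|[set r in R | kappa delta i j k r == 1]| = (m - 3 - n)%N /\
  Spec (Lmul delta (block_idem K delta b)) = sigma K m n.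
Proof.
have [ij ik jk ->] := block_of_supp b_block supp_b; move=> R n; split.
  by rewrite (card_kappa delta_dec ij ik jk) addnK.
exact: Spec_block_idem.
Qed.
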